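(* Let $p_1(t),\dots,p_n(t)\in\mathbb{R}^3$ be the known (possibly time-varying) positions of $n$ anchors, let $\alpha_1,\dots,\alpha_n\in\mathbb{R}$ be constants with $\sum_{i=1}^n\alpha_i=1$, and define $\bar p_j(t)=\sum_{i=1}^n\alpha_i(p_i(t)-p_j(t))$ for $j=1,\dots,n$. Let $C_p(t)$ be the matrix with rows $\bar p_1(t)^\top,\dots,\bar p_n(t)^\top$ and, if an altimeter is used, the additional row $e_3^\top$; assume $C_p(t)$ is bounded. Let $m$ be the number of rows of $C_p(t)$ and let $$A=\begin{bmatrix}0_{3\times 3}&I_3&0_{3\times 3}\\0_{3\times 3}&0_{3\times 3}&I_3\\0_{3\times 3}&0_{3\times 3}&0_{3\times 3}\end{bmatrix},\qquad C(t)=[C_p(t),\,0_{m\times3},\,0_{m\times3}].$$ Then $(A,C(\cdot))$ is uniformly observable if and only if there exist $\delta,\mu>0$ such that for all $t\ge0$ one has $$\frac1\delta\int_t^{t+\delta}\sum_{i=1}^n\bar p_i(s)\bar p_i^\top(s)\,ds+\kappa\, e_3e_3^\top\ge\mu I_3,$$ where $\kappa=1$ if the altimeter is used and $\kappa=0$ otherwise.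
   Context: $e_3=[0,0,1]^\top$. The pair $(A,C(\cdot))$ is uniformly observable if there exist $\delta,\mu>0$ such that for all $t\ge0$, $\int_t^{t+\delta}\Phi^\top(s,t)C^\top(s)C(s)\Phi(s,t)\,ds\ge\mu I_9$, where $\Phi(s,t)=\exp(A(s-t))$. Matrix inequalities are in the positive semidefinite order. Interpretation: a vehicle at position $p(t)$ has range measurements $d_i=\|p-p_i\|$; setting $\bar y_i=\frac12(d_i^2-\|p_i\|^2)$ and $\bar y_0=\sum_i\alpha_i\bar y_i$, one has $\bar y_j-\bar y_0=\bar p_j^\top p$, so the output vector with entries $\bar y_j-\bar y_0$ (together with the altimeter output $e_3^\top p$, if used) equals $C_p(t)p$. *)

(* Defs.v *)
From mathcomp Require Import all_boot all_order all_algebra.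
From mathcomp Require Import all_classical all_reals all_analysis.
Import Order.TTheory GRing.Theory Num.Theory.
Import numFieldNormedType.Exports.

Set Implicit Arguments.
Unset Strict Implicit.
Unset Printing Implicit Defensive.

Local Open Scope classical_set_scope.
Local Open Scope ring_scope.

Section MatrixAnalysis.
Context {R : realType}.

(* The limit is taken in the normed (max-norm) topology of 'M[R]_N. *)
Definition expmx {N : nat} (X : 'M[R]_N) : 'M[R]_N :=
  limn (series (fun k : nat => (k`!%:R)^-1 *: X ^+ k)).

(* The usual entrywise integral only when the entries of F are integrable on
   [a, b]; otherwise it is a junk value. *)
Definition mx_integral {m n : nat} (a b : R) (F : R -> 'M[R]_(m, n)) :
    'M[R]_(m, n) :=
  \matrix_(i, j) \int[lebesgue_measure]_(s in `[a, b]) F s i j.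

Definition psdmx {N : nat} (M : 'M[R]_N) : Prop :=
  M^T = M /\ forall x : 'cV[R]_N, 0 <= (x^T *m M *m x) ord0 ord0.

Definition mx_ge {N : nat} (M M' : 'M[R]_N) : Prop := psdmx (M - M').

Definition uniformly_observable {N m : nat} (A : 'M[R]_N)
    (C : R -> 'M[R]_(m, N)) : Prop :=
  let Phi (s t : R) := expmx ((s - t) *: A) in
  exists delta mu : R, [/\ 0 < delta, 0 < mu &
    forall t : R, 0 <= t ->
      mx_ge
        (mx_integral t (t + delta)
           (fun s => (Phi s t)^T *m (C s)^T *m C s *m Phi s t))
        mu%:M].

End MatrixAnalysis.

Section RangeMeasurements.
Context {R : realType} {n : nat}.

Definition e3 : 'cV[R]_3 := delta_mx ord_max ord0.

Definition pbar (p : 'I_n -> R -> 'cV[R]_3) (alpha : 'I_n -> R) (j : 'I_n)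
    (t : R) : 'cV[R]_3 :=
  \sum_(i < n) alpha i *: (p i t - p j t).

(* The boolean [alt] tells whether an altimeter is used; coerced to nat it is
   the number (0 or 1) of additional rows e_3^T. *)
Definition Cp (alt : bool) (p : 'I_n -> R -> 'cV[R]_3) (alpha : 'I_n -> R)
    (t : R) : 'M[R]_(n + alt, 3) :=
  col_mx (\matrix_(j < n) (pbar p alpha j t)^T) (\matrix_(_ < alt) e3^T).

Definition Amx : 'M[R]_(3 + (3 + 3)) :=
  col_mx (row_mx 0 (row_mx 1%:M 0))
 (col_mx (row_mx 0 (row_mx 0    1%:M))
         (row_mx 0 (row_mx 0    0))).

Definition Cmx (alt : bool) (p : 'I_n -> R -> 'cV[R]_3) (alpha : 'I_n -> R)
    (t : R) : 'M[R]_(n + alt, 3 + (3 + 3)) :=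
  row_mx (Cp alt p alpha t) (row_mx 0 0).

End RangeMeasurements.

(* Main.v *)
Require Import Defs.
From mathcomp Require Import all_boot all_order all_algebra.
From mathcomp Require Import all_classical all_reals all_analysis.
From mathcomp Require Import ring lra.
Import Order.TTheory GRing.Theory Num.Theory.
Import numFieldNormedType.Exports.
Local Open Scope classical_set_scope.
Local Open Scope ring_scope.

(** Since A is nilpotent, C(s) Phi(s,t) (x, y, z) = C_p(s) q(s) where
    q(s) = x + (s - t) y + (s - t)^2/2 z.  Taking y = z = 0 shows that uniform
    observability of (A, C) implies that of C_p.  Conversely, compare the
    integral of |C_p q|^2 over the three windows [t + kL, t + kL + delta],
    k = 0, 1, 2, with the one where q is frozen at its value q(t + kL).  The
    frozen integrals control sum_k |q(t + kL)|^2, hence (x, L y, L^2 z) by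
    interpolation, whereas on each window q varies by only O(delta / L) in
    terms of (L y, L^2 z); as C_p is bounded, a large L makes the error
    negligible. *)

(** * Squared Euclidean norm and scalar lower bounds on quadratic forms *)

Section SquaredNorm.
Context {R : realType}.

(** The canonical norm on matrices is the max-norm, whereas the quadratic forms below need the
    Euclidean one. *)
Definition sqnorm {k : nat} (v : 'cV[R]_k) : R := \sum_(i < k) v i ord0 ^+ 2.

Lemma sqnormE {k : nat} (v : 'cV[R]_k) : (v^T *m v) ord0 ord0 = sqnorm v.
Proof. by rewrite !mxE; apply: eq_bigr => i _; rewrite mxE. Qed.

Lemma sqnorm_ge0 {k : nat} (v : 'cV[R]_k) : 0 <= sqnorm v.
Proof. by apply: sumr_ge0 => i _; exact: sqr_ge0. Qed.

Lemma sqnorm0 {k : nat} : sqnorm (0 : 'cV[R]_k) = 0.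
Proof. by apply: big1 => i _; rewrite mxE expr0n. Qed.

Lemma sqnorm_col_mx {k l : nat} (v : 'cV[R]_k) (w : 'cV[R]_l) :
  sqnorm (col_mx v w) = sqnorm v + sqnorm w.
Proof.
by rewrite /sqnorm big_split_ord; congr (_ + _); apply: eq_bigr => i _;
  rewrite (col_mxEu, col_mxEd).
Qed.

Lemma sqnorm_mulmx {k l : nat} (M : 'M[R]_(k, l)) (v : 'cV[R]_l) :
  (v^T *m (M^T *m M) *m v) ord0 ord0 = sqnorm (M *m v).
Proof. by rewrite -sqnormE trmx_mul !mulmxA. Qed.

(** Entrywise, the right side minus the left side is half the square of [v i + 2 w i]. This
    separates a frozen value [v] from a perturbation [w]. *)
Lemma sqnormD_ge {k : nat} (v w : 'cV[R]_k) :
  2^-1 * sqnorm v - sqnorm w <= sqnorm (v + w).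
Proof.
rewrite mulr_sumr -sumrB; apply: ler_sum => i _; rewrite mxE.
by have := sqr_ge0 (v i ord0 + 2 * w i ord0); nra.
Qed.

Lemma natmul_sum (k : nat) (c : R) : k%:R * c = \sum_(i < k) c.
Proof. by rewrite sumr_const card_ord mulr_natl. Qed.

(** Cauchy-Schwarz against the all-ones vector. In the induction the cross term is split into
    products [2 a_0 a_i], each at most [a_0 ^+ 2 + a_i ^+ 2]. *)
Lemma sqr_sum_le (k : nat) (a : 'I_k -> R) :
  (\sum_i a i) ^+ 2 <= k%:R * \sum_i a i ^+ 2.
Proof.
elim: k a => [|k IHk] a; first by rewrite !big_ord0 expr0n mul0r.
rewrite !big_ord_recl; set S := \sum_i _; set Q := \sum_i _.
have cross : 2 * (a ord0 * S) <= k%:R * a ord0 ^+ 2 + Q.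
  rewrite (natmul_sum k) -big_split !mulr_sumr /=; apply: ler_sum => i _ /=.
  by have := sqr_ge0 (a ord0 - a (lift ord0 i)); nra.
have := IHk (fun i => a (lift ord0 i)); rewrite -/S -/Q -natr1 => SQ; nra.
Qed.

Lemma sqnorm_mulmx_le {k l : nat} (K : R) (M : 'M[R]_(k, l)) (v : 'cV[R]_l) :
  (forall i j, `|M i j| <= K) ->
  sqnorm (M *m v) <= k%:R * l%:R * K ^+ 2 * sqnorm v.
Proof.
move=> MK; rewrite -2!mulrA (natmul_sum k) {1}/sqnorm.
apply: ler_sum => i _; rewrite mxE (le_trans (sqr_sum_le _ _)) //.
rewrite ler_wpM2l // mulr_sumr; apply: ler_sum => j _.
rewrite exprMn ler_wpM2r ?sqr_ge0 // -real_normK ?num_real //.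
by rewrite ler_pXn2r ?nnegrE ?MK // (le_trans _ (MK i j)).
Qed.

Lemma quad_scalar {k : nat} (mu : R) (x : 'cV[R]_k) :
  (x^T *m mu%:M *m x) ord0 ord0 = mu * sqnorm x.
Proof. by rewrite mul_mx_scalar -scalemxAl mxE sqnormE. Qed.

(** Symmetry is part of [psdmx], so it is supplied separately; what remains is an inequality between
    quadratic forms. *)
Lemma mx_ge_scalarP {k : nat} (M : 'M[R]_k) (mu : R) : M^T = M ->
  mx_ge M mu%:M <->
  forall x : 'cV[R]_k, mu * sqnorm x <= (x^T *m M *m x) ord0 ord0.
Proof.
move=> Msym; split=> [[_ H] x|H].
  have := H x; rewrite mulmxBr mulmxBl mxE [X in _ + X]mxE quad_scalar.
  by rewrite subr_ge0.
split; first by rewrite linearB /= Msym tr_scalar_mx.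
by move=> x; rewrite mulmxBr mulmxBl mxE [X in _ + X]mxE quad_scalar subr_ge0.
Qed.

End SquaredNorm.

(** * Bounded measurable functions and entrywise integrals *)

Section BoundedMeasurable.
Context {R : realType}.
Implicit Types (D : set R) (f g : R -> R).

(** Unlike integrability, this class is stable under products, and on a compact interval it implies
    integrability. *)
Definition bounded_measurable D f : Prop :=
  measurable_fun D f /\ exists K : R, forall s, D s -> `|f s| <= K.

Lemma bounded_measurable_cst D (c : R) : bounded_measurable D (fun=> c).
Proof. by split; [exact: measurable_cst|exists `|c|]. Qed.

Lemma bounded_measurable_id (a b : R) : bounded_measurable `[a, b] id.
Proof.
split; first exact: measurable_id.
exists (`|a| + `|b|) => s /=; rewrite in_itv /= => /andP[as_ sb].
have := ler_norm b; have := ler_norm (- a); rewrite normrN.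
by rewrite ler_norml => *; have := normr_ge0 a; have := normr_ge0 b; lra.
Qed.

Lemma bounded_measurableD D f g : bounded_measurable D f ->
  bounded_measurable D g -> bounded_measurable D (fun s => f s + g s).
Proof.
move=> [mf [K fK]] [mg [L gL]]; split.
  exact: measurable_realfun.measurable_funD.
exists (K + L) => s Ds.
by rewrite (le_trans (ler_normD _ _)) // lerD ?fK ?gL.
Qed.

Lemma bounded_measurableM D f g : bounded_measurable D f ->
  bounded_measurable D g -> bounded_measurable D (fun s => f s * g s).
Proof.
move=> [mf [K fK]] [mg [L gL]]; split.
  exact: measurable_realfun.measurable_funM.
by exists (K * L) => s Ds; rewrite normrM ler_pM ?fK ?gL.
Qed.

Lemma bounded_measurable_sum D (k : nat) (f : 'I_k -> R -> R) :
  (forall i, bounded_measurable D (f i)) ->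
  bounded_measurable D (fun s => \sum_i f i s).
Proof.
elim: k f => [|k IHk] f bf.
  by under eq_fun do rewrite big_ord0; exact: bounded_measurable_cst.
under eq_fun do rewrite big_ord_recl.
by apply: bounded_measurableD => //; exact: IHk.
Qed.

Lemma bounded_measurableS (D E : set R) f : measurable E -> D `<=` E ->
  bounded_measurable E f -> bounded_measurable D f.
Proof.
move=> mE DE [mf [K fK]]; split; first exact: measurable_funS mf.
by exists K => s /DE /fK.
Qed.

Lemma bounded_measurable_integrable (a b : R) f :
  bounded_measurable `[a, b] f ->
  (@lebesgue_measure R).-integrable `[a, b] (EFin \o f).
Proof.
move=> [mf [K fK]]; apply: measurable_bounded_integrable => //.
  by rewrite /= lebesgue_measure_itv /=; case: ifP => // _; exact: ltry.
exists K; split; first exact: num_real.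
by move=> x Kx s /fK /le_trans; apply; exact: ltW.
Qed.

Definition mx_bounded_measurable D {k l : nat} (F : R -> 'M[R]_(k, l)) : Prop :=
  forall i j, bounded_measurable D (fun s => F s i j).

Lemma mx_bounded_measurable_cst D {k l : nat} (M : 'M[R]_(k, l)) :
  mx_bounded_measurable D (fun=> M).
Proof. by move=> i j; exact: bounded_measurable_cst. Qed.

Lemma mx_bounded_measurableD D {k l : nat} (F G : R -> 'M[R]_(k, l)) :
  mx_bounded_measurable D F -> mx_bounded_measurable D G ->
  mx_bounded_measurable D (fun s => F s + G s).
Proof.
move=> bF bG i j; under eq_fun do rewrite mxE.
exact: bounded_measurableD.
Qed.

Lemma mx_bounded_measurableZ D {k l : nat} f (F : R -> 'M[R]_(k, l)) :
  bounded_measurable D f -> mx_bounded_measurable D F ->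
  mx_bounded_measurable D (fun s => f s *: F s).
Proof.
move=> bf bF i j; under eq_fun do rewrite mxE.
exact: bounded_measurableM.
Qed.

Lemma mx_bounded_measurableM D {k l m : nat} (F : R -> 'M[R]_(k, l))
    (G : R -> 'M[R]_(l, m)) :
  mx_bounded_measurable D F -> mx_bounded_measurable D G ->
  mx_bounded_measurable D (fun s => F s *m G s).
Proof.
move=> bF bG i j; under eq_fun do rewrite mxE.
by apply: bounded_measurable_sum => h; exact: bounded_measurableM.
Qed.

Lemma mx_bounded_measurable_tr D {k l : nat} (F : R -> 'M[R]_(k, l)) :
  mx_bounded_measurable D F -> mx_bounded_measurable D (fun s => (F s)^T).
Proof. by move=> bF i j; under eq_fun do rewrite mxE; exact: bF. Qed.

Lemma mx_bounded_measurable_row D {k l m : nat} (F : R -> 'M[R]_(k, l))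
    (G : R -> 'M[R]_(k, m)) :
  mx_bounded_measurable D F -> mx_bounded_measurable D G ->
  mx_bounded_measurable D (fun s => row_mx (F s) (G s)).
Proof.
move=> bF bG i j; rewrite -(splitK j).
by case: (fintype.split j) => h /=;
  under eq_fun do rewrite (row_mxEl, row_mxEr);
  [exact: bF|exact: bG].
Qed.

Lemma entry_le_mx_norm {k l : nat} (M : 'M[R]_(k, l)) i j : `|M i j| <= `|M|.
Proof.
rewrite [leRHS]/Num.Def.normr /= mx_normrE.
by apply/bigmax_geP; right; exists (i, j).
Qed.

Lemma bounded_entries {k l : nat} (F : R -> 'M[R]_(k, l)) (D : set R) :
  [bounded F t | t in D] ->
  exists K : R, forall s i j, D s -> `|F s i j| <= K.
Proof.
(* The boundedness predicate only provides bounds strictly above [K], hence [K + 1]. *)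
move=> [K [_ FK]]; exists (K + 1) => s i j Ds.
by rewrite (le_trans (entry_le_mx_norm _ i j)) // FK // ltrDl.
Qed.

Lemma mx_bounded_measurable_itv {k l : nat} (F : R -> 'M[R]_(k, l)) (a b : R) :
  0 <= a -> mx_bounded_measurable `[0, +oo[ F ->
  mx_bounded_measurable `[a, b] F.
Proof.
move=> a0 bF i j; apply: bounded_measurableS (bF i j) => // s /=.
by rewrite !in_itv /= andbT => /andP[/(le_trans a0)].
Qed.

Lemma bounded_measurable_sqnorm D {k : nat} (F : R -> 'cV[R]_k) :
  mx_bounded_measurable D F -> bounded_measurable D (fun s => sqnorm (F s)).
Proof.
move=> bF; apply: bounded_measurable_sum => i.
by under eq_fun do rewrite expr2; exact: bounded_measurableM.
Qed.

Lemma Rintegral_sum (a b : R) (k : nat) (f : 'I_k -> R -> R) :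
  (forall i, bounded_measurable `[a, b] (f i)) ->
  \int[lebesgue_measure]_(s in `[a, b]) (\sum_i f i s) =
  \sum_i \int[lebesgue_measure]_(s in `[a, b]) f i s.
Proof.
elim: k f => [|k IHk] f bf.
  rewrite big_ord0; under eq_Rintegral do rewrite big_ord0.
  by rewrite Rintegral_cst ?mul0r.
rewrite big_ord_recl -IHk //; under eq_Rintegral do rewrite big_ord_recl.
by rewrite RintegralD //; apply: bounded_measurable_integrable => //;
  exact: bounded_measurable_sum.
Qed.

(** Linearity of the integral, applied to the two finite sums of the matrix products; it turns
    matrix inequalities on integrals into scalar ones. *)
Lemma quad_mx_integral (a b : R) {k : nat} (F : R -> 'M[R]_k) (x : 'cV[R]_k) :
  mx_bounded_measurable `[a, b] F ->
  (x^T *m mx_integral a b F *m x) ord0 ord0 =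
  \int[lebesgue_measure]_(s in `[a, b]) (x^T *m F s *m x) ord0 ord0.
Proof.
move=> bF; under eq_Rintegral do rewrite mxE.
rewrite mxE Rintegral_sum; last first.
  move=> j; apply: bounded_measurableM; last exact: bounded_measurable_cst.
  apply: mx_bounded_measurableM => //; exact: mx_bounded_measurable_cst.
apply: eq_bigr => j _; rewrite RintegralZr //; last first.
  apply: bounded_measurable_integrable; apply: mx_bounded_measurableM => //.
  exact: mx_bounded_measurable_cst.
congr (_ * _); rewrite mxE; under eq_Rintegral do rewrite mxE.
rewrite Rintegral_sum => [|i].
  apply: eq_bigr => i _; rewrite RintegralZl ?mxE //.
  exact: bounded_measurable_integrable.
by apply: bounded_measurableM; first exact: bounded_measurable_cst.
Qed.

Lemma mx_integral_sym (a b : R) {k : nat} (F : R -> 'M[R]_k) :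
  (forall s, (F s)^T = F s) -> (mx_integral a b F)^T = mx_integral a b F.
Proof.
move=> Fsym; apply/matrixP => i j; rewrite !mxE.
by apply: eq_Rintegral => s _; rewrite -[in LHS]Fsym mxE.
Qed.

Lemma ge0_Rintegral_subitv (a b c d : R) f : c <= a -> b <= d ->
  bounded_measurable `[c, d] f -> (forall s, 0 <= f s) ->
  \int[lebesgue_measure]_(s in `[a, b]) f s <=
  \int[lebesgue_measure]_(s in `[c, d]) f s.
Proof.
move=> ca bd bf f0; have sub : `[a, b] `<=` `[c, d].
  by apply: subset_itv; rewrite bnd_simp.
have int_cd := bounded_measurable_integrable _ _ _ bf.
have int_ab : lebesgue_measure.-integrable `[a, b] (EFin \o f).
  by apply: integrableS int_cd.
rewrite /Rintegral fine_le ?integrable_fin_num //.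
apply: ge0_subset_integral => //; first exact: measurable_int int_cd.
by move=> s _; rewrite lee_fin.
Qed.

End BoundedMeasurable.

(** * Motions with constant acceleration *)

Section QuadraticPath.
Context {R : realType}.

(** Position at time [r] for initial position [x], velocity [y] and constant acceleration [z].
    Matrix arguments are allowed so that the same formula also expresses the exponential of
    [r *: Amx]. *)
Definition quadratic_path {k l : nat} (x y z : 'M[R]_(k, l)) (r : R) :
    'M[R]_(k, l) :=
  x + r *: y + (r ^+ 2 / 2) *: z.

(** Taking [L] as the unit of time moves the sampling instants [0], [L], [2 L] to [0], [1], [2],
    where constants no longer depend on [L]. *)
Lemma quadratic_pathZ {k l : nat} (x y z : 'M[R]_(k, l)) (L r : R) : L != 0 ->
  quadratic_path x (L *: y) (L ^+ 2 *: z) (r / L) = quadratic_path x y z r.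
Proof.
move=> L0; rewrite /quadratic_path !scalerA; congr (_ + _ *: _ + _ *: _);
  by field.
Qed.

Lemma mx_bounded_measurable_quadratic_path {k l : nat} (x y z : 'M[R]_(k, l))
    (a b t : R) :
  mx_bounded_measurable `[a, b] (fun s => quadratic_path x y z (s - t)).
Proof.
have bst : bounded_measurable `[a, b] (fun s => s - t).
  apply: bounded_measurableD; first exact: bounded_measurable_id.
  exact: bounded_measurable_cst.
apply: mx_bounded_measurableD; first apply: mx_bounded_measurableD.
- exact: mx_bounded_measurable_cst.
- by apply: mx_bounded_measurableZ => //; exact: mx_bounded_measurable_cst.
apply: mx_bounded_measurableZ; last exact: mx_bounded_measurable_cst.
apply: bounded_measurableM; last exact: bounded_measurable_cst.
exact: (bounded_measurableM _ _ _ bst bst).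
Qed.

End QuadraticPath.

(** * Exponential of the nilpotent system matrix *)

Section NilpotentExponential.
Context {R : realType}.

(** The partial sums of the exponential series are constant from rank 3 on. *)
Lemma expmx_nilpotent3 {k : nat} (X : 'M[R]_k) : X ^+ 3 = 0 ->
  expmx X = 1 + X + 2^-1 *: X ^+ 2.
Proof.
move=> X3; apply: norm_lim_near_cst; exists 3%N => // N /= le3N.
rewrite /series /= -(subnKC le3N) -{2}[3%N]add0n.
rewrite (@big_cat_nat _ _ _ 3) ?leq_addr //= [X in _ + X]big1_seq ?addr0.
  rewrite !big_nat_recr //= big_geq // add0r.
  by rewrite expr0 expr1 fact0 factS fact0 !mulr1n invr1 !scale1r.
move=> j /andP[_]; rewrite mem_index_iota => /andP[le3j _].
by rewrite -(subnKC le3j) exprD X3 mul0r scaler0.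
Qed.

Lemma Amx_shift {w : nat} (X Y Z : 'M[R]_(3, w)) :
  Amx *m col_mx X (col_mx Y Z) = col_mx Y (col_mx Z 0).
Proof.
by rewrite /Amx !mul_col_mx !mul_row_col !mul0mx !mul1mx !add0r !addr0.
Qed.

Lemma Amx_cube0 : (Amx : 'M[R]_(3 + (3 + 3))) ^+ 3 = 0.
Proof.
(* The cube is applied to the identity cut into three row blocks, and three shifts push every block
   out. *)
rewrite !exprS expr0 mulr1 -[LHS]mulmx1 -!mulmxA.
by rewrite -[1%:M]vsubmxK -[dsubmx _]vsubmxK !Amx_shift !col_mx0.
Qed.

(* [exprZn] needs an algebra structure, absent from ['M_k] for variable [k]. *)
Lemma expr_scalemx {k : nat} (c : R) (X : 'M[R]_k) (j : nat) :
  (c *: X) ^+ j = c ^+ j *: X ^+ j.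
Proof.
elim: j => [|j IHj]; first by rewrite !expr0 scale1r.
rewrite !exprS IHj -[LHS]/(_ *m _) -scalemxAl -scalemxAr scalerA.
by congr (_ *: _).
Qed.

Lemma expmx_Amx (tau : R) :
  expmx (tau *: Amx) = quadratic_path 1 Amx (Amx ^+ 2) tau.
Proof.
rewrite expmx_nilpotent3 expr_scalemx ?Amx_cube0 ?scaler0 //.
by rewrite scalerA mulrC.
Qed.

Lemma expmx_Amx_col (tau : R) {w : nat} (X Y Z : 'M[R]_(3, w)) :
  usubmx (expmx (tau *: Amx) *m col_mx X (col_mx Y Z)) =
  quadratic_path X Y Z tau.
Proof.
rewrite expmx_Amx /quadratic_path expr2 !mulmxDl -!scalemxAl -mulmxA.
by rewrite mul1mx !Amx_shift !scale_col_mx !add_col_mx col_mxKu.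
Qed.

End NilpotentExponential.

(** * From constant vectors to quadratic paths by sampling three windows *)

Section ThreeWindows.
Context {R : realType}.

(** A quadratic polynomial is determined by its values at 0, 1 and 2. By Cauchy-Schwarz, the
    formulas recovering [a], [b], [c] from these values have squared norms 1, 13/2 and 6, whose sum
    is below 14. *)
Lemma quadratic_samples_ge (a b c : R) :
  a ^+ 2 + b ^+ 2 + c ^+ 2 <=
  14 * (a ^+ 2 + (a + b + c / 2) ^+ 2 + (a + 2 * b + 2 * c) ^+ 2).
Proof.
set u := a + b + c / 2; set v := a + 2 * b + 2 * c.
(* Finite differences of the samples: [c] is the second difference. *)
have -> : c = v - 2 * u + a by rewrite /u /v; field.
have -> : b = (4 * u - v - 3 * a) / 2 by rewrite /u /v; field.
have := sqr_ge0 (a + 2 * u); have := sqr_ge0 (a - v).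
have := sqr_ge0 (2 * v + u); have := sqr_ge0 a; have := sqr_ge0 u.
nra.
Qed.

Lemma sqnorm_quadratic_samples_ge {d : nat} (x y z : 'cV[R]_d) :
  sqnorm x + sqnorm y + sqnorm z <=
  14 * (sqnorm (quadratic_path x y z 0) + sqnorm (quadratic_path x y z 1)
        + sqnorm (quadratic_path x y z 2)).
Proof.
rewrite -!big_split mulr_sumr; apply: ler_sum => i _ /=.
have := quadratic_samples_ge (x i ord0) (y i ord0) (z i ord0).
rewrite /quadratic_path !mxE => /le_trans; apply.
by rewrite le_eqVlt; apply/orP; left; apply/eqP; field.
Qed.

(** The initial position [x] cancels in the increment, which is [r] times [y + (c + r / 2) z]. As
    [c + r / 2] is at most 3, Cauchy-Schwarz gives the factor [1 + 9]. *)
Lemma sqnorm_quadratic_path_sub {d : nat} (x y z : 'cV[R]_d) (c r e : R) :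
  0 <= c <= 2 -> 0 <= r <= e -> e <= 1 ->
  sqnorm (quadratic_path x y z (c + r) - quadratic_path x y z c) <=
  10 * e ^+ 2 * (sqnorm y + sqnorm z).
Proof.
move=> /andP[c0 c2] /andP[r0 re] e1.
rewrite -big_split mulr_sumr; apply: ler_sum => i _ /=.
rewrite /quadratic_path !mxE; set a := y i ord0; set b := z i ord0.
have -> : x i ord0 + (c + r) * a + (c + r) ^+ 2 / 2 * b
    - (x i ord0 + c * a + c ^+ 2 / 2 * b) = r * (a + (c + r / 2) * b).
  by field.
have cauchy : (a + (c + r / 2) * b) ^+ 2 <= 10 * (a ^+ 2 + b ^+ 2).
  set h := c + r / 2.
  have h2 : h ^+ 2 <= 9.
    have [h0 h3] : 0 <= h /\ h <= 3 by rewrite /h; split; lra.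
    nra.
  have := sqr_ge0 (h * a - b); have := sqr_ge0 a; have := sqr_ge0 b; nra.
rewrite exprMn [10 * _]mulrC -[leRHS]mulrA; apply: ler_pM;
  rewrite ?sqr_ge0 //.
by rewrite ler_pXn2r ?nnegrE // (le_trans r0).
Qed.

Lemma window_lower_bound {m d : nat} (C : R -> 'M[R]_(m, d))
    (w : R -> 'cV[R]_d) (q : 'cV[R]_d) (a delta mu K E : R) : 0 <= delta ->
  mx_bounded_measurable `[a, a + delta] C ->
  (forall s i j, `[a, a + delta]%classic s -> `|C s i j| <= K) ->
  mx_bounded_measurable `[a, a + delta] w ->
  (forall s, `[a, a + delta]%classic s -> sqnorm (w s - q) <= E) ->
  mu * sqnorm q <=
    \int[lebesgue_measure]_(s in `[a, a + delta]) sqnorm (C s *m q) ->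
  mu / 2 * sqnorm q - delta * (m%:R * d%:R * K ^+ 2 * E) <=
    \int[lebesgue_measure]_(s in `[a, a + delta]) sqnorm (C s *m w s).
Proof.
move=> delta0 bC CK bw wE mu_le; set B := m%:R * d%:R * K ^+ 2.
have bCq : bounded_measurable `[a, a + delta] (fun s => sqnorm (C s *m q)).
  apply: bounded_measurable_sqnorm; apply: mx_bounded_measurableM => //.
  exact: mx_bounded_measurable_cst.
have bCw : bounded_measurable `[a, a + delta] (fun s => sqnorm (C s *m w s)).
  by apply: bounded_measurable_sqnorm; exact: mx_bounded_measurableM.
have bCq2 : bounded_measurable `[a, a + delta]
    (fun s => 2^-1 * sqnorm (C s *m q)).
  by apply: bounded_measurableM => //; exact: bounded_measurable_cst.
have ptwise s : `[a, a + delta]%classic s ->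
    2^-1 * sqnorm (C s *m q) - B * E <= sqnorm (C s *m w s).
  move=> as_; have := sqnormD_ge (C s *m q) (C s *m (w s - q)).
  rewrite -mulmxDr [q + _]addrC subrK; apply: le_trans.
  rewrite lerB //; apply: le_trans (sqnorm_mulmx_le K _ _ _) _.
    by move=> i j; exact: CK.
  by rewrite ler_wpM2l ?wE // mulr_ge0 ?sqr_ge0 // mulr_ge0.
have -> : mu / 2 * sqnorm q - delta * (B * E) =
    2^-1 * (mu * sqnorm q) - B * E * delta by ring.
have -> : B * E * delta =
    \int[lebesgue_measure]_(s in `[a, a + delta]) (B * E).
  rewrite Rintegral_cst //= lebesgue_measure_itv /= lte_fin ltrDl.
  (* For [delta = 0] the interval has measure zero and both sides vanish. *)
  case: ltP => [_|le_d0]; first by rewrite /= addrAC subrr add0r.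
  by rewrite (le_anti (_ : delta <= 0 <= delta)) ?mulr0 // le_d0.
apply: (@le_trans _ _ (\int[lebesgue_measure]_(s in `[a, a + delta])
    (2^-1 * sqnorm (C s *m q) - B * E))).
  have iCq := bounded_measurable_integrable _ _ _ bCq.
  have iCq2 := bounded_measurable_integrable _ _ _ bCq2.
  have iBE := bounded_measurable_integrable _ _ _
    (bounded_measurable_cst `[a, a + delta] (B * E)).
  by rewrite RintegralB // (RintegralZl _ _ iCq) // lerB // ler_wpM2l.
apply: le_Rintegral => //; apply: bounded_measurable_integrable => //.
by apply: bounded_measurableD => //; exact: bounded_measurable_cst.
Qed.

Lemma persistent_excitation_quadratic {m d : nat} (C : R -> 'M[R]_(m, d))
    (K delta mu : R) : 0 < delta -> 0 < mu ->
  mx_bounded_measurable `[0, +oo[ C ->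
  (forall s i j, 0 <= s -> `|C s i j| <= K) ->
  (forall t (v : 'cV[R]_d), 0 <= t -> mu * sqnorm v <=
    \int[lebesgue_measure]_(s in `[t, t + delta]) sqnorm (C s *m v)) ->
  exists delta' mu' : R, [/\ 0 < delta', 0 < mu' &
    forall t (x y z : 'cV[R]_d), 0 <= t ->
      mu' * (sqnorm x + sqnorm y + sqnorm z) <=
      \int[lebesgue_measure]_(s in `[t, t + delta'])
        sqnorm (C s *m quadratic_path x y z (s - t))].
Proof.
move=> delta0 mu0 bC CK Cmu; set B := m%:R * d%:R * K ^+ 2.
have B0 : 0 <= B by rewrite mulr_ge0 ?sqr_ge0 // mulr_ge0.
(* With [L >= 1] and [L >= Q], [L ^+ 2 >= Q], which makes the error on the
   three windows at most half of the frozen lower bound. *)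
set Q := 30 * 56 * delta ^+ 3 * B / mu.
have Q0 : 0 <= Q.
  apply: divr_ge0 (ltW mu0); apply: mulr_ge0 B0.
  by rewrite mulr_ge0 // exprn_ge0 // ltW.
pose L := 1 + delta + Q; have L1 : 1 <= L by rewrite /L; lra.
have L0 : 0 < L by lra.
(* The length [2 * L + delta] covers the three windows. Summing their bounds gives [mu / 28] (half
   of [mu], over 14) minus an error of at most [mu / 56], hence [mu / 56] for three times the
   integral [I]. *)
exists (2 * L + delta), (mu / 168); split; [lra|lra|move=> t x y z t0].
set I := \int[lebesgue_measure]_(_ in _) _.
pose e := delta / L.
(* The summand [delta] of [L] serves here: rescaled windows have length at most 1. *)
have e1 : e <= 1 by rewrite ler_pdivrMr // mul1r /L; lra.
have small : 30 * (delta * (B * e ^+ 2)) <= mu / 56.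
  have -> : 30 * (delta * (B * e ^+ 2)) = mu / 56 * (Q / L ^+ 2).
    by rewrite /e /Q; field; rewrite !gt_eqF.
  rewrite ler_piMr ?divr_ge0 ?(ltW mu0) // ler_pdivrMr ?exprn_gt0 // mul1r.
  by rewrite /L in L1 L0 *; nra.
pose y' := L *: y; pose z' := L ^+ 2 *: z.
(* Bounding each window separately by [I] costs a factor 3 but does not require
   the windows to be disjoint. *)
have window c : 0 <= c <= 2 ->
    mu / 2 * sqnorm (quadratic_path x y' z' c)
    - delta * (B * (10 * e ^+ 2 * (sqnorm y' + sqnorm z'))) <= I.
  move=> c02; have [c0 c2] := andP c02.
  have cL0 : 0 <= c * L by rewrite mulr_ge0 // ltW.
  have cL2 : c * L <= 2 * L by rewrite ler_wpM2r // ltW.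
  apply: (le_trans (window_lower_bound C
    (fun s => quadratic_path x y z (s - t)) _ (t + c * L) delta mu K _
    (ltW delta0) _ _ _ _ _)).
  - by apply: mx_bounded_measurable_itv => //; lra.
  - move=> s i j /=; rewrite in_itv /= => /andP[ts _]; apply: CK; lra.
  - exact: mx_bounded_measurable_quadratic_path.
  - move=> s /=; rewrite in_itv /= => /andP[ts st].
    rewrite -(quadratic_pathZ _ _ _ L) ?gt_eqF //.
    (* In the unit [L], the window starts at the sampling node [c] and has length [e]. *)
    have -> : (s - t) / L = c + (s - t - c * L) / L.
      by field; rewrite gt_eqF.
    apply: sqnorm_quadratic_path_sub => //.
    by rewrite divr_ge0 ?(ltW L0) ?ler_wpM2r ?invr_ge0 ?(ltW L0) //=; lra.
  - by apply: Cmu; lra.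
  apply: ge0_Rintegral_subitv; [lra|lra| |by move=> s; exact: sqnorm_ge0].
  apply: bounded_measurable_sqnorm; apply: mx_bounded_measurableM.
    by apply: mx_bounded_measurable_itv => //; lra.
  exact: mx_bounded_measurable_quadratic_path.
have w0 := window 0 ltac:(lra); have w1 := window 1 ltac:(lra).
have w2 := window 2 ltac:(lra).
have samples := sqnorm_quadratic_samples_ge x y' z'.
set Y := sqnorm x + sqnorm y' + sqnorm z' in samples.
have Y_ge : sqnorm x + sqnorm y + sqnorm z <= Y.
  have sqnormZ (c : R) (v : 'cV[R]_d) : sqnorm (c *: v) = c ^+ 2 * sqnorm v.
    by rewrite mulr_sumr; apply: eq_bigr => i _; rewrite mxE exprMn.
  have L2 : 1 <= L ^+ 2 by rewrite exprn_ege1.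
  rewrite /Y !sqnormZ -exprM !lerD // ler_peMl ?sqnorm_ge0 //.
  by rewrite exprn_ege1.
have yz_le : sqnorm y' + sqnorm z' <= Y.
  by rewrite /Y -addrA lerDr sqnorm_ge0.
have Y0 : 0 <= Y by rewrite !addr_ge0 ?sqnorm_ge0.
have err : 3 * (delta * (B * (10 * e ^+ 2 * (sqnorm y' + sqnorm z'))))
    <= mu / 56 * Y.
  apply: le_trans (ler_wpM2r Y0 small).
  have -> : 3 * (delta * (B * (10 * e ^+ 2 * (sqnorm y' + sqnorm z')))) =
      30 * (delta * (B * e ^+ 2)) * (sqnorm y' + sqnorm z') by ring.
  rewrite ler_wpM2l // mulr_ge0 // mulr_ge0 ?(ltW delta0) //.
  by rewrite mulr_ge0 // sqr_ge0.
have muY : mu * (sqnorm x + sqnorm y + sqnorm z) <= mu * Y.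
  by rewrite ler_wpM2l // ltW.
have musamples := ler_wpM2l (ltW mu0) samples.
lra.
Qed.

End ThreeWindows.

(** * Both Gramians as integrals of squared outputs *)

Section RangeObservability.
Context {R : realType} {n : nat}.
Context (alt : bool) (p : 'I_n -> R -> 'cV[R]_3) (alpha : 'I_n -> R).
Let C := Cp alt p alpha.

(** A Gram matrix is the sum of the outer products of the rows, and the altimeter block has one row
    or none. *)
Lemma Cp_gram (s : R) :
  (C s)^T *m C s = \sum_(i < n) pbar p alpha i s *m (pbar p alpha i s)^T
    + (if alt then 1 else 0) *: (e3 *m e3^T).
Proof.
rewrite /C /Cp tr_col_mx mul_row_col; congr (_ + _); apply/matrixP => i j.
  rewrite summxE !mxE; apply: eq_bigr => k _.
  by rewrite !mxE big_ord1 !mxE.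
rewrite !mxE big_ord1 !mxE; case: alt => /=.
  by rewrite big_ord1 mul1r !mxE.
by rewrite big_ord0 mul0r.
Qed.

Lemma mulmx_Cmx (s : R) {w : nat} (X : 'M[R]_(3 + (3 + 3), w)) :
  Cmx alt p alpha s *m X = C s *m usubmx X.
Proof. by rewrite /Cmx -{1}[X]vsubmxK mul_row_col row_mx0 mul0mx addr0. Qed.

Context (bC : mx_bounded_measurable `[0, +oo[ C).

(** The output matrix only sees the first block of the propagated state, and that block is a
    quadratic path. *)
Lemma observability_gramian_quad (t d : R) (x y z : 'cV[R]_3) : 0 <= t ->
  let Phi (s t : R) := expmx ((s - t) *: Amx) in
  ((col_mx x (col_mx y z))^T *m
    mx_integral t (t + d) (fun s => (Phi s t)^T *m (Cmx alt p alpha s)^T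
      *m Cmx alt p alpha s *m Phi s t) *m col_mx x (col_mx y z)) ord0 ord0 =
  \int[lebesgue_measure]_(s in `[t, t + d])
    sqnorm (C s *m quadratic_path x y z (s - t)).
Proof.
move=> t0 Phi; rewrite quad_mx_integral.
  apply: eq_Rintegral => s _; rewrite -trmx_mul -[_ *m _ *m Phi s t]mulmxA.
  by rewrite sqnorm_mulmx -mulmxA mulmx_Cmx expmx_Amx_col.
have bCmx : mx_bounded_measurable `[t, t + d] (Cmx alt p alpha).
  apply: mx_bounded_measurable_row; first exact: mx_bounded_measurable_itv.
  exact: mx_bounded_measurable_cst.
have bPhi : mx_bounded_measurable `[t, t + d] (fun s => Phi s t).
  rewrite (_ : (fun s => _) =
    fun s => quadratic_path 1 Amx (Amx ^+ 2) (s - t)).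
    exact: mx_bounded_measurable_quadratic_path.
  by apply/funext => s; exact: expmx_Amx.
apply: mx_bounded_measurableM => //; apply: mx_bounded_measurableM => //.
by apply: mx_bounded_measurableM => //; exact: mx_bounded_measurable_tr.
Qed.

(** Averaging over a window of length [d] preserves constants, so the altimeter term can be moved
    under the integral, where it completes the Gram matrix of [C]. *)
Lemma excitation_quad (t d : R) (v : 'cV[R]_3) : 0 <= t -> 0 < d ->
  (v^T *m (d^-1 *: mx_integral t (t + d)
      (fun s => \sum_(i < n) pbar p alpha i s *m (pbar p alpha i s)^T)
    + (if alt then 1 else 0) *: (e3 *m e3^T)) *m v) ord0 ord0 =
  d^-1 * \int[lebesgue_measure]_(s in `[t, t + d]) sqnorm (C s *m v).
Proof.
move=> t0 d0; set E := _ *: (e3 *m _).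
have gramE s : \sum_(i < n) pbar p alpha i s *m (pbar p alpha i s)^T =
    (C s)^T *m C s + (- E) by rewrite Cp_gram addrK.
have bCC : mx_bounded_measurable `[t, t + d] (fun s => (C s)^T *m C s).
  apply: mx_bounded_measurableM; last exact: mx_bounded_measurable_itv.
  by apply: mx_bounded_measurable_tr; exact: mx_bounded_measurable_itv.
have bE : mx_bounded_measurable `[t, t + d] (fun=> - E).
  exact: mx_bounded_measurable_cst.
have -> : mx_integral t (t + d)
      (fun s => \sum_(i < n) pbar p alpha i s *m (pbar p alpha i s)^T) =
    mx_integral t (t + d) (fun s => (C s)^T *m C s) - d *: E.
  apply/matrixP => i j; rewrite !mxE; under eq_Rintegral do rewrite gramE mxE.
  rewrite RintegralD //; try exact: bounded_measurable_integrable.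
  congr (_ + _).
  rewrite Rintegral_cst //= lebesgue_measure_itv /= lte_fin ltrDl d0 /=.
  by rewrite !mxE addrAC subrr add0r mulrC mulrN.
rewrite scalerBr scalerA mulVf ?gt_eqF // scale1r subrK.
rewrite -scalemxAr -scalemxAl mxE quad_mx_integral //; congr (_ * _).
by apply: eq_Rintegral => s _; rewrite sqnorm_mulmx.
Qed.

End RangeObservability.

Theorem lemma2 (R : realType) (n : nat) (alt : bool)
    (p : 'I_n -> R -> 'cV[R]_3) (alpha : 'I_n -> R)
    (sum_alpha : \sum_(i < n) alpha i = 1)
    (Cp_meas : forall (i : 'I_(n + alt)) (k : 'I_3),
       measurable_fun (`[0, +oo[ : set R) (fun t : R => Cp alt p alpha t i k))
    (Cp_bounded : [bounded Cp alt p alpha t | t in (`[0, +oo[ : set R)]) :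
  uniformly_observable Amx (Cmx alt p alpha) <->
  exists delta mu : R, [/\ 0 < delta, 0 < mu &
    forall t : R, 0 <= t ->
      mx_ge
        (delta^-1 *: mx_integral t (t + delta)
            (fun s => \sum_(i < n) pbar p alpha i s *m (pbar p alpha i s)^T)
         + (if alt then 1 else 0) *: (e3 *m e3^T))
        mu%:M].
Proof.
have [K CK] := bounded_entries _ _ Cp_bounded.
have bC : mx_bounded_measurable `[0, +oo[ (Cp alt p alpha).
  by move=> i k; split; [exact: Cp_meas|exists K => s; exact: CK].
have gramian_sym t d : (mx_integral t (t + d)
    (fun s => (expmx ((s - t) *: Amx))^T *m (Cmx alt p alpha s)^T
      *m Cmx alt p alpha s *m expmx ((s - t) *: Amx)))^T = mx_integral t (t + d)
    (fun s => (expmx ((s - t) *: Amx))^T *m (Cmx alt p alpha s)^T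
      *m Cmx alt p alpha s *m expmx ((s - t) *: Amx)).
  by apply: mx_integral_sym => s; rewrite !trmx_mul !trmxK !mulmxA.
have excitation_sym t d : (d^-1 *: mx_integral t (t + d)
      (fun s => \sum_(i < n) pbar p alpha i s *m (pbar p alpha i s)^T)
    + (if alt then 1 else 0) *: (e3 *m e3^T))^T = d^-1 *: mx_integral t (t + d)
      (fun s => \sum_(i < n) pbar p alpha i s *m (pbar p alpha i s)^T)
    + (if alt then 1 else 0) *: (e3 *m e3^T).
  rewrite linearD !linearZ /= trmx_mul trmxK mx_integral_sym // => s.
  by rewrite linear_sum; apply: eq_bigr => i _; rewrite /= trmx_mul trmxK.
split=> -[delta [mu [delta0 mu0 H]]].
  (* The excitation condition is an average, so [mu] is divided by the window length. *)
  exists delta, (delta^-1 * mu); split=> [//||t t0].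
    by rewrite mulr_gt0 ?invr_gt0.
  apply/mx_ge_scalarP => // v; rewrite excitation_quad // -mulrA.
  rewrite ler_wpM2l ?invr_ge0 ?(ltW delta0) //.
  (* With zero velocity and acceleration the path stays at [v]. *)
  have /mx_ge_scalarP/(_ (col_mx v (col_mx 0 0))) := H t t0.
  rewrite observability_gramian_quad // !sqnorm_col_mx !sqnorm0 !addr0.
  move=> /(_ (gramian_sym t delta)) /le_trans; apply.
  rewrite le_eqVlt; apply/orP; left; apply/eqP; apply: eq_Rintegral => s _.
  by rewrite /quadratic_path !scaler0 !addr0.
(* Conversely, [delta * mu] undoes the averaging before the three-window estimate is applied. *)
have [//||t v t0|delta' [mu' [delta'0 mu'0 H']]] :=
    persistent_excitation_quadratic (Cp alt p alpha) K delta (delta * mu)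
      delta0 _ bC _ _.
- by rewrite mulr_gt0.
- by move=> s i j s0; apply: CK; rewrite /= in_itv /= s0.
- have /mx_ge_scalarP/(_ v) := H t t0.
  rewrite excitation_quad // => /(_ (excitation_sym t delta)).
  by rewrite [leRHS]mulrC ler_pdivlMr // mulrC mulrA.
exists delta', mu'; split=> // t t0; apply/mx_ge_scalarP => // x.
rewrite -[x]vsubmxK -[dsubmx x]vsubmxK observability_gramian_quad //.
by rewrite !sqnorm_col_mx addrA; exact: H'.
Qed.
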